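(* Let $t\ge s>0$ be fixed. (1) If $H\in(0,\frac12)$, then, as $u\to0+$, $$\hat r_H(t,s|u)=r_H(t,s)-C_H u^{2H}+o\left(u^{2H}\right),$$ where $$C_H=\frac{d_H^2}{2H}\left(H-\frac12\right)^2\left(\int_1^\infty w^{H-\frac32}(w-1)^{H-\frac12}\,\mathrm{d}w\right)^2.$$ (2) If $H\in(\frac12,1)$, then, as $u\to0+$, $$\hat r_H(t,s|u)=r_H(t,s)-C_{H,t,s}u^{2-2H}+o\left(u^{2-2H}\right),$$ where $$C_{H,t,s}=\frac{d_H^2(ts)^{2H-1}}{8-8H}.$$
   Context: For $H\in(0,1)$ let $r_H(t,s)=\frac12\left[t^{2H}+s^{2H}-|t-s|^{2H}\right]$ be the covariance of fractional Brownian motion $B^H$ with Hurst index $H$, and for $0<v<t$ let $$k_H(t,v)=d_H\left[\left(\tfrac{t}{v}\right)^{H-\frac12}(t-v)^{H-\frac12}-\left(H-\tfrac12\right)v^{\frac12-H}\int_v^t z^{H-\frac32}(z-v)^{H-\frac12}\,\mathrm{d}z\right],\qquad d_H=\sqrt{\frac{2H\,\Gamma(\frac32-H)}{\Gamma(H+\frac12)\Gamma(2-2H)}}.$$ It is a known fact that $B^H_t=\int_0^t k_H(t,v)\,\mathrm{d}W_v$ for a Brownian motion $W$ generating the same filtration as $B^H$. The conditional covariance of $B^H_t$ and $B^H_s$ given $\mathcal{F}_u=\sigma(B^H_v:v\le u)$ is, for $0<u<s\le t$, $$\hat r_H(t,s|u)=r_H(t,s)-\int_0^u k_H(t,v)k_H(s,v)\,\mathrm{d}v.$$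 *)

(* Defs.v *)
From mathcomp Require Import all_boot all_order all_algebra.
From mathcomp Require Import all_classical all_reals all_analysis.

Set Implicit Arguments.
Unset Strict Implicit.
Unset Printing Implicit Defensive.

Import Order.TTheory GRing.Theory Num.Theory.
Import numFieldNormedType.Exports.

Local Open Scope classical_set_scope.
Local Open Scope ring_scope.

(* All integrals are Lebesgue integrals: the integrands may be unbounded at the
   endpoints. Open intervals keep the points where a negative power is singular
   outside the domain of integration. *)

Section FractionalBrownianMotion.
Context {R : realType}.
Implicit Types H t s u v : R.

Definition Gamma (x : R) : R :=
  \int[lebesgue_measure]_(z in `]0, +oo[) (z `^ (x - 1) * expR (- z)).

Definition fBm_cov H t s : R :=
  2^-1 * (t `^ (2 * H) + s `^ (2 * H) - `|t - s| `^ (2 * H)).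

Definition fBm_d H : R :=
  Num.sqrt (2 * H * Gamma (3 / 2 - H) / (Gamma (H + 1 / 2) * Gamma (2 - 2 * H))).

(* The kernel k_H of the representation of B^H_t as the integral of k_H(t, v)
   against dW_v over 0 < v < t; it is meaningful only for 0 < v < t. *)
Definition fBm_kernel H t v : R :=
  fBm_d H *
  ((t / v) `^ (H - 1 / 2) * (t - v) `^ (H - 1 / 2)
   - (H - 1 / 2) * v `^ (1 / 2 - H) *
     \int[lebesgue_measure]_(z in `]v, t[)
       (z `^ (H - 3 / 2) * (z - v) `^ (H - 1 / 2))).

(* The covariance of B^H_t and B^H_s conditional on (B^H_v)_(v <= u), for
   0 < u < s <= t. It is deterministic and is given by its expression in terms
   of the kernel k_H. *)
Definition fBm_cond_cov H t s u : R :=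
  fBm_cov H t s -
  \int[lebesgue_measure]_(v in `]0, u[) (fBm_kernel H t v * fBm_kernel H s v).

Definition small_H_const H : R :=
  fBm_d H ^+ 2 / (2 * H) * (H - 1 / 2) ^+ 2 *
  (\int[lebesgue_measure]_(w in `]1, +oo[)
     (w `^ (H - 3 / 2) * (w - 1) `^ (H - 1 / 2))) ^+ 2.

Definition large_H_const H t s : R :=
  fBm_d H ^+ 2 * (t * s) `^ (2 * H - 1) / (8 - 8 * H).

End FractionalBrownianMotion.

(* Main.v *)
Require Import Defs.
From HB Require Import structures.
From mathcomp Require Import all_boot all_order all_algebra.
From mathcomp Require Import all_classical all_reals all_analysis.
From mathcomp Require Import measurable_realfun ring lra.
Import Order.TTheory GRing.Theory Num.Theory.
Import numFieldNormedType.Exports.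
Local Open Scope classical_set_scope.
Local Open Scope ring_scope.

(* Write a = H - 1/2 and J(v) for the integral of z^(a-1) (z-v)^a over ]v, t[, so
   that k_H(t, v) = d_H v^(-a) (t^a (t-v)^a - a J(v)).
   For a < 0, the substitution z = v w gives J(v) = v^(2a) I(t/v), where I(x) is
   the integral of w^(a-1) (w-1)^a over ]1, x[ and converges as x -> +oo; the
   term a J(v) dominates and v^(-a) k_H(t, v) tends to - d_H a I(+oo).
   For a > 0, the inequalities z^(2a-1) - v z^(2a-2) <= z^(a-1) (z-v)^a <= z^(2a-1)
   give J(v) -> t^(2a) / (2a), hence v^a k_H(t, v) tends to d_H t^(2a) / 2.
   In both cases the product of the two kernels is nonnegative and equivalent
   to c v^p with p > -1, and the asymptotics is integrated over ]0, u[. *)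

Section FractionalKernel.
Set Implicit Arguments.
Unset Strict Implicit.
Context {R : realType}.
Import HBNNSimple.
Local Notation mu := (@lebesgue_measure R).

(** * Monotonicity of the integral and integrals of powers *)

(** The integral of a nonnegative function is the supremum over the simple functions below it, and a
    larger function has more of them. This covers integrands whose measurability is not established,
    such as $k_H(t,\cdot)k_H(s,\cdot)$. *)
Lemma ge0_le_integral_nonmeasurable {d} {T : measurableType d}
    (m : {measure set T -> \bar R}) (D : set T) (f g : T -> \bar R) :
  (forall x, D x -> (0 <= f x)%E) -> (forall x, D x -> (f x <= g x)%E) ->
  (\int[m]_(x in D) f x <= \int[m]_(x in D) g x)%E.
Proof.
move=> f0 fg; rewrite !ge0_integralE//; last first.
  by move=> x Dx; exact: le_trans (f0 x Dx) (fg x Dx).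
apply: le_ereal_sup => _ [h hf <-]; exists h => // x.
apply: le_trans (hf x) _; rewrite /patch.
by case: ifPn => // /set_mem; exact: fg.
Qed.

Lemma is_derive_powRB (c p x : R) : c < x ->
  is_derive x 1 (fun z => (z - c) `^ p) (p * (x - c) `^ (p - 1)).
Proof.
move=> cx; have xc : 0 < x - c by rewrite subr_gt0.
have := @is_derive1_comp R (fun y => y `^ p) (fun z => z - c) x _ 1
  (is_derive1_powR p xc) _.
rewrite mulr1; apply.
have /= := @is_deriveB R _ _ id (cst c) x 1 1 0 (is_derive_id _ _) (is_derive_cst _ _ _).
by rewrite subr0.
Qed.

Lemma continuous_powRB (c p x : R) : c < x ->
  {for x, continuous (fun z => (z - c) `^ p)}.
Proof.
move=> cx; apply: differentiable_continuous; apply/derivable1_diffP.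
by have [] := is_derive_powRB p cx.
Qed.

Lemma measurable_powRB (D : set R) (c p : R) : measurable D ->
  measurable_fun D (fun z : R => (z - c) `^ p).
Proof.
move=> mD; apply: (@measurableT_comp _ _ _ _ _ _ (fun y : R => y `^ p));
  first exact: measurable_powR.
exact: measurable_funB.
Qed.

(** Since [c < a], the singularity at [c] stays outside [[a, b]] and the fundamental theorem of
    calculus applies for every exponent other than -1. *)
Lemma integral_powRB (c p a b : R) : p != -1 -> c < a -> a <= b ->
  (\int[mu]_(z in `]a, b[) ((z - c) `^ p)%:E =
    (((b - c) `^ (p + 1) - (a - c) `^ (p + 1)) / (p + 1))%:E)%E.
Proof.
move=> p1 ca; rewrite le_eqVlt => /predU1P[<-|ab].
  by rewrite set_itv_ge ?integral_set0 ?subrr ?mul0r// bnd_simp ltxx.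
have p10 : p + 1 != 0 by rewrite addr_eq0.
pose F z := (p + 1)^-1 * (z - c) `^ (p + 1).
have dF z : c < z -> is_derive z 1 F ((z - c) `^ p).
  move=> cz; have := is_deriveZ (p + 1)^-1 (is_derive_powRB (p + 1) cz).
  by rewrite addrK /= scalerA mulVf// scale1r.
have cF z : c < z -> {for z, continuous F}.
  move=> /dF[dz _]; apply: differentiable_continuous.
  exact/derivable1_diffP.
transitivity (\int[mu]_(z in `[a, b]) ((z - c) `^ p)%:E)%E.
  by rewrite (integral_itv_bndoo true false)//;
   apply/measurable_EFinP; apply: measurable_powRB.
rewrite (@continuous_FTC2 _ _ F)//.
- by rewrite -EFinD /F -mulrBr mulrC.
- apply: continuous_in_subspaceT => z /set_mem /=; rewrite in_itv/= => /andP[az _].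
  by apply: continuous_powRB; exact: lt_le_trans az.
- split.
  + move=> z; rewrite in_itv/= => /andP[az _].
    by have [] := dF z (lt_trans ca az).
  + by apply: cvg_at_right_filter; exact: cF.
  + by apply: cvg_at_left_filter; apply: cF; exact: lt_trans ab.
- move=> z; rewrite in_itv/= => /andP[az _].
  by rewrite derive1E; have [_ ->] := dF z (lt_trans ca az).
Qed.

Lemma cvg_integral_itv_left (f : R -> R) (c b : R) : c < b ->
  measurable_fun `]c, b[ f -> (forall x, `]c, b[%classic x -> 0 <= f x) ->
  (\int[mu]_(z in `](c + (b - c) / n.+1%:R)%R, b[) (f z)%:E)%E @[n --> \oo] -->
  (\int[mu]_(z in `]c, b[) (f z)%:E)%E.
Proof.
move=> cb mf f0; have bc : 0 < b - c by rewrite subr_gt0.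
have cn n : c < c + (b - c) / n.+1%:R by rewrite ltrDl divr_gt0.
have sub n : `](c + (b - c) / n.+1%:R), b[ `<=` `]c, b[.
  by apply: subset_itv; rewrite bnd_simp// ltW.
have -> : `]c, b[%classic = \bigcup_n `](c + (b - c) / n.+1%:R), b[%classic.
  apply/seteqP; split=> [z|z [n _] /sub//].
  rewrite /= in_itv/= => /andP[cz zb].
  have zc : 0 < z - c by rewrite subr_gt0.
  (* This index n satisfies n + 1 > (b - c) / (z - c), that is, c + (b - c) / (n + 1) < z. *)
  exists (Num.truncn ((b - c) / (z - c))) => //=.
  rewrite in_itv/= zb andbT -ltrBrDl ltr_pdivrMr// mulrC -ltr_pdivrMr//.
  exact: truncnS_gt.
apply: ge0_nondecreasing_set_cvg_integral => //.
- move=> n m nm; apply/subsetPset; apply: subset_itv; rewrite bnd_simp//.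
  by rewrite lerD2l ler_pM2l// lef_pV2 ?posrE// ler_nat.
- by move=> n; apply/measurable_EFinP; exact: measurable_funS mf.
- by move=> n z /sub; rewrite lee_fin; exact: f0.
Qed.

(** Exhaust []c, b[] from the left: the boundary term of [integral_powRB] at c + (b - c) / (n + 1)
    vanishes in the limit because p + 1 > 0. *)
Lemma integral_powRB_singular (c p b : R) : -1 < p -> c < b ->
  (\int[mu]_(z in `]c, b[) ((z - c) `^ p)%:E =
    ((b - c) `^ (p + 1) / (p + 1))%:E)%E.
Proof.
move=> p1 cb; have bc : 0 < b - c by rewrite subr_gt0.
have p10 : 0 < p + 1 by rewrite -ltrBlDr sub0r.
have h := cvg_integral_itv_left cb (measurable_powRB c p (measurable_itv _))
  (fun x _ => powR_ge0 _ _).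
apply: (cvg_unique _ h) => //.
rewrite (_ : (fun n => _) = fun n => (((b - c) `^ (p + 1) -
    ((b - c) / n.+1%:R) `^ (p + 1)) / (p + 1))%:E); last first.
  apply/funext => n; rewrite integral_powRB.
  - by rewrite addrAC subrr add0r.
  - by rewrite gt_eqF.
  - by rewrite ltrDl divr_gt0.
  - rewrite -lerBrDl ler_pdivrMr// ler_peMr// ?(ltW bc)//.
    by rewrite ler1n.
apply: cvg_EFin; first exact: nearW.
apply: cvgMr_tmp; rewrite -[X in _ --> X]subr0.
apply: cvgB; first exact: cvg_cst.
have /cvg_at_rightP := powR_cvg0 p10; apply; split.
  by move=> n; rewrite divr_gt0.
rewrite -[X in _ --> X](mulr0 (b - c)).
by apply: cvgMl_tmp; exact: cvg_harmonic.
Qed.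

(** * The substitution z = v w and the integral I(x) for a < 0 *)

(** Lebesgue measure equals v times its pushforward under w -> v w: by uniqueness it suffices to
    compare the two on the intervals []a, b]]. *)
Lemma ge0_integral_scale (v : R) (D : set R) (f : R -> R) : 0 < v -> measurable D ->
  measurable_fun D f -> (forall x, D x -> 0 <= f x) ->
  (\int[mu]_(z in D) (f z)%:E =
   v%:E * \int[mu]_(w in [set w | D (v * w)%R]) (f (v * w)%R)%:E)%E.
Proof.
move=> v0 mD mf f0.
have mv : measurable_fun setT (fun w : measurableTypeR R => v * w : measurableTypeR R).
  exact: measurable_funM.
pose phi : {mfun measurableTypeR R >-> measurableTypeR R} :=
  HB.pack (fun w : measurableTypeR R => v * w : measurableTypeR R)
    (isMeasurableFun.Build _ _ _ _ _ mv).
rewrite (@eq_measure_integral _ _ _ _ (mscale (NngNum (ltW v0)) (pushforward mu phi)));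
  last first.
  move=> A mA _; apply: lebesgue_measure_unique => // _ [[a b]] _ <-.
  have phiE : phi @^-1` `]a, b] = `](a / v), (b / v)]%classic.
    by apply/seteqP; split=> z /=; rewrite !in_itv/= ltr_pdivrMr// ler_pdivlMr// mulrC.
  transitivity (v%:E * mu (phi @^-1` `]a, b]))%E => //.
  rewrite phiE !lebesgue_measure_itv/= !lte_fin ltr_pM2r ?invr_gt0//.
  case: ifPn => // _; last by rewrite mule0.
  by rewrite -!EFinD -EFinM -mulrBl mulrC divfK// gt_eqF.
rewrite ge0_integral_mscale//=; last exact/measurable_EFinP.
by rewrite (@ge0_integral_pushforward _ _ _ _ _ phi)//; [exact/measurable_EFinP|
 move=> x /set_mem xD; rewrite lee_fin; exact: f0].
Qed.

Definition scaled_integrand (a w : R) : R := w `^ (a - 1) * (w - 1) `^ a.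

Lemma measurable_powR_powRB (D : set R) (p q c : R) : measurable D ->
  measurable_fun D (fun z : R => z `^ p * (z - c) `^ q).
Proof.
move=> mD; apply: measurable_funM; last exact: measurable_powRB.
exact: measurable_funTS (measurable_powR p).
Qed.

Lemma scaled_integrand_ge0 a w : 0 <= scaled_integrand a w.
Proof. by rewrite mulr_ge0// powR_ge0. Qed.

Lemma integral_powR (p a b : R) : p != -1 -> 0 < a -> a <= b ->
  (\int[mu]_(z in `]a, b[) (z `^ p)%:E =
    ((b `^ (p + 1) - a `^ (p + 1)) / (p + 1))%:E)%E.
Proof.
move=> p1 a0 ab; have := @integral_powRB 0 p a b p1 a0 ab.
by rewrite !subr0 => <-; apply: eq_integral => z _; rewrite subr0.
Qed.

Lemma ge0_subset_integral_itv (A B : set R) (f : R -> R) :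
  measurable A -> measurable B -> measurable_fun B f -> (forall x, 0 <= f x) ->
  A `<=` B -> (\int[mu]_(x in A) (f x)%:E <= \int[mu]_(x in B) (f x)%:E)%E.
Proof.
move=> mA mB mf f0 AB; apply: ge0_subset_integral => //.
  exact/measurable_EFinP.
by move=> x _; rewrite lee_fin.
Qed.

(** Split at 2. Below 2, w^(a-1) <= 1, and (w-1)^a has integral 1/(a+1) over ]1, 2[. Above 2,
    (w-1)^a <= 1, and w^(a-1) has integral at most -1/a. *)
Lemma scaled_integral_bounded (a x : R) : -1 < a < 0 ->
  (\int[mu]_(w in `]1%R, x[) (scaled_integrand a w)%:E <= ((a + 1)^-1 - a^-1)%:E)%E.
Proof.
move=> /andP[a1 a0].
have mf (D : set R) : measurable D -> measurable_fun D (scaled_integrand a).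
  exact: measurable_powR_powRB.
have le1 : (\int[mu]_(w in `]1%R, 2%R[) (scaled_integrand a w)%:E <= ((a + 1)^-1)%:E)%E.
  have -> : (a + 1)^-1 = (2 - 1) `^ (a + 1) / (a + 1).
    by rewrite (_ : 2 - 1 = 1 :> R) ?powR1 ?mul1r//; ring.
  rewrite -integral_powRB_singular// ?ltr1n//.
  apply: ge0_le_integral_nonmeasurable => w /=; rewrite in_itv/= => /andP[w1 _].
    by rewrite lee_fin scaled_integrand_ge0.
  rewrite lee_fin /scaled_integrand ler_piMl ?powR_ge0//.
  rewrite -[leRHS](powRr0 w) ler_powR ?(ltW w1)//; lra.
have le2 : (\int[mu]_(w in `[2%R, x[) (scaled_integrand a w)%:E <= (- a^-1)%:E)%E.
  have [x2|x2] := ltP x 2.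
    rewrite set_itv_ge ?integral_set0 ?bnd_simp -?leNgt ?(ltW x2)//.
    by rewrite lee_fin oppr_ge0 invr_le0 ltW.
  apply: (@le_trans _ _ (\int[mu]_(w in `[2%R, x[) (w `^ (a - 1))%:E)%E).
    apply: ge0_le_integral_nonmeasurable => w /=; rewrite in_itv/= => /andP[w2 _].
      by rewrite lee_fin scaled_integrand_ge0.
    rewrite lee_fin /scaled_integrand ler_piMr ?powR_ge0//.
    by rewrite -[leRHS](powRr0 (w - 1)) ler_powR ?(ltW a0)//; lra.
  (* Enlarging the domain down to 1 makes the integral (x^a - 1)/a, which is at most -1/a since a <
     0. *)
  apply: (@le_trans _ _ (\int[mu]_(w in `]1%R, x[) (w `^ (a - 1))%:E)%E).
    apply: ge0_subset_integral_itv => //.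
    - exact: measurable_funTS (measurable_powR _).
    - by move=> w; exact: powR_ge0.
    - by apply: subset_itv; rewrite bnd_simp// ltr1n.
  rewrite integral_powR//; [|by rewrite lt_eqF//; lra|lra].
  rewrite subrK powR1 mulrBl mul1r lee_fin lerBlDr addNr.
  by rewrite mulr_ge0_le0 ?powR_ge0// invr_le0 ltW.
apply: (@le_trans _ _ (\int[mu]_(w in `]1%R, 2%R[ `|` `[2%R, x[) (scaled_integrand a w)%:E)%E).
  apply: ge0_subset_integral_itv => //.
  - exact: measurableU.
  - by apply: mf; exact: measurableU.
  - exact: scaled_integrand_ge0.
  - move=> w /=; rewrite !in_itv/= => /andP[-> ->].
    by case: (ltP w 2) => _; [left|right].
rewrite ge0_integral_setU//=.
- by rewrite EFinB; exact: leeD.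
- by apply/measurable_EFinP; apply: mf; exact: measurableU.
- by move=> w _; rewrite lee_fin scaled_integrand_ge0.
- apply/disj_setPS => w [] /=; rewrite !in_itv/= => /andP[_ w2] /andP[].
  by rewrite leNgt w2.
Qed.

(** Monotone convergence gives the limit along integers, the uniform bound makes it finite, and
    monotonicity in x extends the convergence to real x. *)
Lemma scaled_integral_cvgy (a : R) : -1 < a < 0 ->
  \int[mu]_(w in `]1, x[) scaled_integrand a w @[x --> +oo] -->
  \int[mu]_(w in `]1, +oo[) scaled_integrand a w.
Proof.
move=> a01.
have mf (D : set R) : measurable D -> measurable_fun D (scaled_integrand a).
  exact: measurable_powR_powRB.
(* Taking an interval bound as argument makes the truncated and the full integral values of one
   monotone function. *)
pose I (x : itv_bound R) :=
  (\int[mu]_(w in [set` Interval (BRight 1%R) x]) (scaled_integrand a w)%:E)%E.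
have I0 x : (0 <= I x)%E by apply: integral_ge0 => w _; rewrite lee_fin scaled_integrand_ge0.
have I_le x y : (x <= y)%O -> (I x <= I y)%E.
  move=> xy; apply: ge0_subset_integral_itv => //; first exact: mf.
    exact: scaled_integrand_ge0.
  by apply: subset_itvl.
have Icvg : I (BLeft n%:R) @[n --> \oo] --> I +oo%O.
  rewrite /I (_ : `]1%R, +oo[%classic = \bigcup_n `]1%R, n%:R%R[%classic); last first.
    apply/seteqP; split=> [z /=|z [n _] /=]; rewrite !in_itv/= ?andbT; last by case/andP.
    move=> z1; exists (Num.truncn z).+1 => //=; rewrite in_itv/= z1/=.
    exact: truncnS_gt.
  apply: ge0_nondecreasing_set_cvg_integral => //.
  - move=> n m nm; apply/subsetPset; apply: subset_itvl.
    by rewrite bnd_simp ler_nat.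
  - by move=> n; apply/measurable_EFinP; exact: mf.
  - by move=> n x _; rewrite lee_fin scaled_integrand_ge0.
have Iub n : (I (BLeft n%:R) <= ((a + 1)^-1 - a^-1)%:E)%E by exact: scaled_integral_bounded.
have Iy_le : (I +oo%O <= ((a + 1)^-1 - a^-1)%:E)%E.
  by apply: (@cvge_le _ _ _ _ _ _ _ _ Icvg); exact: nearW.
have Iyfin : I +oo%O \is a fin_num.
  by rewrite ge0_fin_numE// (le_lt_trans Iy_le)// ltry.
have Ifin x : I x \is a fin_num.
  rewrite ge0_fin_numE//; apply: (@le_lt_trans _ _ (I +oo%O)); last first.
    by rewrite -ge0_fin_numE.
  by apply: I_le; rewrite bound_lex1.
have fI_le x y : (x <= y)%O -> fine (I x) <= fine (I y) by move=> /I_le; exact: fine_le.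
have fIcvg : fine (I (BLeft n%:R)) @[n --> \oo] --> fine (I +oo%O).
  by apply: fine_cvg; rewrite fineK.
apply/cvgrPdist_le => e e0.
have /cvgrPdist_le/(_ e e0)[N _ /(_ N (leqnn N)) hN] := fIcvg.
near=> x.
have xN : fine (I (BLeft N%:R)) <= fine (I (BLeft x)).
  by apply: fI_le; rewrite bnd_simp; near: x; exact: nbhs_pinfty_ge.
have xy : fine (I (BLeft x)) <= fine (I +oo%O) by apply: fI_le; rewrite bound_lex1.
move: hN; rewrite /Rintegral -/(I _) -/(I (BLeft x)) !ger0_norm ?subr_ge0//; last first.
  exact: le_trans xy.
by apply: le_trans; rewrite lerD2l lerN2.
Unshelve. all: by end_near. Qed.

(** The integrand is homogeneous of degree 2a - 1 in (z, v), and dz = v dw supplies one more factor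
    v. *)
Lemma kernel_integral_scale (a v t : R) : 0 < v ->
  \int[mu]_(z in `]v, t[) (z `^ (a - 1) * (z - v) `^ a) =
  v `^ (2 * a) * \int[mu]_(w in `]1, t / v[) scaled_integrand a w.
Proof.
move=> v0; rewrite /Rintegral (ge0_integral_scale v0)//; last 2 first.
- exact: measurable_powR_powRB.
- by move=> z _; rewrite mulr_ge0// powR_ge0.
have -> : [set w | `]v, t[%classic (v * w)] = `]1, t / v[%classic.
  apply/seteqP; split=> w /=;
  by rewrite !in_itv/= ltr_pMr// ltr_pdivlMr// mulrC.
have -> : (\int[mu]_(w in `]1%R, (t / v)%R[) ((v * w) `^ (a - 1) * (v * w - v) `^ a)%:E =
    (v `^ (2 * a - 1))%:E * \int[mu]_(w in `]1%R, (t / v)%R[) (scaled_integrand a w)%:E)%E.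
  rewrite -ge0_integralZl_EFin//; last 3 first.
  - by move=> w _; rewrite lee_fin scaled_integrand_ge0.
  - by apply/measurable_EFinP; exact: measurable_powR_powRB.
  - exact: powR_ge0.
  apply: eq_integral => w /set_mem /=; rewrite in_itv/= => /andP[w1 _].
  rewrite -EFinM /scaled_integrand; congr EFin.
  rewrite -[X in v * w - X]mulr1 -mulrBr.
  rewrite !powRM ?(ltW v0) ?subr_ge0 ?(ltW w1)//; last by rewrite (le_trans ler01)// ltW.
  rewrite mulrACA -powRD; last by rewrite (gt_eqF v0) implybT.
  by congr (_ `^ _ * _); ring.
rewrite muleA -EFinM.
have -> : v * v `^ (2 * a - 1) = v `^ (2 * a).
  rewrite -[X in X * _]powRr1 ?ltW// -powRD; last by rewrite (gt_eqF v0) implybT.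
  by congr (_ `^ _); ring.
have v2a : 0 < v `^ (2 * a) by exact: powR_gt0.
(* If the integral is infinite, so is its product with v^(2a) > 0, and [fine] sends both to 0. *)
case: (\int[mu]_(w in _) _)%E => [r||] //=.
- by rewrite gt0_muley ?lte_fin//= mulr0.
- by rewrite gt0_muleNy ?lte_fin//= mulr0.
Qed.

(** * Two-sided bounds on J(v) for a > 0 *)

(** Above, (z-v)^a <= z^a. Below, z^(a-1) <= (z-v)^(a-1) since a < 1; multiply by (z-v) z^(a-1). The
    correction v z^(2a-2) integrates to at most v^(2a)/(1-2a), because 2a - 1 < 0. *)
Lemma kernel_integral_bounds (a v t : R) : 0 < a < 1 / 2 -> 0 < v < t ->
  t `^ (2 * a) / (2 * a) - ((2 * a)^-1 + (1 - 2 * a)^-1) * v `^ (2 * a) <=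
  \int[mu]_(z in `]v, t[) (z `^ (a - 1) * (z - v) `^ a) <= t `^ (2 * a) / (2 * a).
Proof.
move=> /andP[a0 a12] /andP[v0 vt].
pose f z := z `^ (a - 1) * (z - v) `^ a.
have f0 z : 0 <= f z by rewrite mulr_ge0// powR_ge0.
have a2 : 0 < 2 * a by lra.
have a2' : 0 < 1 - 2 * a by lra.
have I1 : (\int[mu]_(z in `]v, t[) (z `^ (2 * a - 1))%:E =
    ((t `^ (2 * a) - v `^ (2 * a)) / (2 * a))%:E)%E.
  by rewrite integral_powR// ?subrK// ?ltW// gt_eqF//; lra.
have ub : (\int[mu]_(z in `]v, t[) (f z)%:E <= (t `^ (2 * a) / (2 * a))%:E)%E.
  apply: (@le_trans _ _ (\int[mu]_(z in `]v, t[) (z `^ (2 * a - 1))%:E)%E).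
    apply: ge0_le_integral_nonmeasurable => z /=; rewrite in_itv/= => /andP[vz _].
      by rewrite lee_fin.
    have z0 : 0 < z by exact: lt_trans vz.
    rewrite lee_fin /f (_ : 2 * a - 1 = (a - 1) + a); last by ring.
    rewrite (@powRD _ z (a - 1) a) ?(gt_eqF z0) ?implybT// ler_wpM2l ?powR_ge0//.
    by rewrite ge0_ler_powR ?nnegrE ?ltW//; lra.
  by rewrite I1 lee_fin ler_pM2r ?invr_gt0// gerBl powR_ge0.
(* The correction is added on the right, so that all integrands are nonnegative. *)
have lb : (((t `^ (2 * a) - v `^ (2 * a)) / (2 * a))%:E <=
    \int[mu]_(z in `]v, t[) (f z)%:E + ((1 - 2 * a)^-1 * v `^ (2 * a))%:E)%E.
  have mf (D : set R) : measurable D -> measurable_fun D f.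
    exact: measurable_powR_powRB.
  have I2 : (\int[mu]_(z in `]v, t[) (v * z `^ (2 * a - 2))%:E <=
      ((1 - 2 * a)^-1 * v `^ (2 * a))%:E)%E.
    have -> : (\int[mu]_(z in `]v, t[) (v * z `^ (2 * a - 2))%:E =
        v%:E * \int[mu]_(z in `]v, t[) (z `^ (2 * a - 2))%:E)%E.
      rewrite -ge0_integralZl_EFin ?ltW//.
      - by move=> z _; rewrite lee_fin powR_ge0.
      - by apply/measurable_EFinP; exact: measurable_funTS (measurable_powR _).
    rewrite integral_powR// ?(ltW vt)//; last by rewrite lt_eqF//; lra.
    rewrite -EFinM lee_fin (_ : 2 * a - 2 + 1 = 2 * a - 1); last by ring.
    have vE := mulr_powRB1 (ltW v0) a2.
    rewrite [leLHS](_ : _ = (1 - 2 * a)^-1 * (v * v `^ (2 * a - 1)) -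
        (1 - 2 * a)^-1 * (v * t `^ (2 * a - 1))); last first.
      by field; rewrite gt_eqF//= lt_eqF//; lra.
    by rewrite vE gerBl mulr_ge0 ?invr_ge0 ?(ltW a2')// mulr_ge0 ?powR_ge0// ltW.
  rewrite -I1; apply: le_trans (leeD (le_refl _) I2).
  rewrite -ge0_integralD//.
  - apply: ge0_le_integral_nonmeasurable => z /=; rewrite in_itv/= => /andP[vz _].
      by rewrite lee_fin powR_ge0.
    have z0 : 0 < z by exact: lt_trans vz.
    have zv : 0 < z - v by rewrite subr_gt0.
    rewrite -EFinD lee_fin -lerBlDr.
    have -> : z `^ (2 * a - 1) - v * z `^ (2 * a - 2) =
        z `^ (a - 1) * ((z - v) * z `^ (a - 1)).
      rewrite mulrCA -powRD ?(gt_eqF z0) ?implybT//.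
      rewrite mulrBl; congr (_ - _); last by congr (_ * _ `^ _); ring.
      rewrite -[X in _ = X * _](powRr1 (ltW z0)) -powRD ?(gt_eqF z0) ?implybT//.
      by congr (_ `^ _); ring.
    rewrite /f ler_wpM2l ?powR_ge0// -(mulr_powRB1 (ltW zv) a0) ler_wpM2l ?(ltW zv)//.
    (* With a - 1 = -(1 - a), the comparison becomes the monotonicity of the positive power 1 -
       a. *)
    rewrite -(opprB 1 a) !powRN lef_pV2 ?posrE ?powR_gt0//.
    rewrite ge0_ler_powR ?nnegrE ?(ltW z0) ?(ltW zv)//; first lra.
    by rewrite gerBl ltW.
  - by move=> z _; rewrite lee_fin.
  - by apply/measurable_EFinP; exact: mf.
  - by move=> z _; rewrite lee_fin mulr_ge0 ?powR_ge0// ltW.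
  - apply/measurable_EFinP; apply: measurable_funM => //.
    exact: measurable_funTS (measurable_powR _).
have fin : (\int[mu]_(z in `]v, t[) (f z)%:E)%E \is a fin_num.
  rewrite ge0_fin_numE ?(le_lt_trans ub) ?ltry//.
  by apply: integral_ge0 => z _; rewrite lee_fin.
move: lb ub; rewrite /Rintegral -(fineK fin) -EFinD !lee_fin => lb ->.
rewrite andbT.
move: lb; rewrite -lerBlDr; apply: le_trans.
by rewrite le_eqVlt; apply/orP; left; apply/eqP; field; rewrite !gt_eqF.
Qed.

(** * Integrating an equivalence at 0 *)

(** Near 0, g(v) lies between two multiples of v^p with coefficients close to c, and v^p integrates
    to u^(p+1)/(p+1) over ]0, u[. *)
Lemma integral0_asymp (g : R -> R) (c p : R) : -1 < p ->
  (\forall v \near 0^'+, 0 <= g v) ->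
  g v * v `^ (- p) @[v --> 0^'+] --> c ->
  forall e, 0 < e -> \forall u \near 0^'+,
    `|\int[mu]_(v in `]0, u[) g v - c / (p + 1) * u `^ (p + 1)| <= e * u `^ (p + 1).
Proof.
move=> p1 g0 gc e e0.
have p10 : 0 < p + 1 by rewrite -ltrBlDr sub0r.
have pe : 0 < e * (p + 1) by rewrite mulr_gt0.
(* The tolerance e (p + 1) becomes e after the division by p + 1. *)
have [d /= d0 hd] : \forall v \near 0^'+,
    0 <= g v /\ `|c - g v * v `^ (- p)| <= e * (p + 1).
  by apply: filterI => //; move/cvgrPdist_le : gc; exact.
near=> u.
have u0 : 0 < u by near: u; exact: nbhs_right_gt.
have ud : u < d by near: u; exact: nbhs_right_lt.
have {}hd v : `]0, u[%classic v -> [/\ 0 < v, 0 <= g v & `|c - g v * v `^ (- p)| <= e * (p + 1)].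
  rewrite /= in_itv/= => /andP[v0 vu].
  have [] := hd v _ v0; last by [].
  by rewrite /ball_/= sub0r normrN gtr0_norm// (lt_trans vu).
have up0 : 0 <= u `^ (p + 1) by exact: powR_ge0.
have Ip k : 0 <= k -> (\int[mu]_(v in `]0%R, u[) (k * v `^ p)%:E =
    (k / (p + 1) * u `^ (p + 1))%:E)%E.
  move=> k0; have -> : (\int[mu]_(v in `]0%R, u[) (k * v `^ p)%:E =
      k%:E * \int[mu]_(v in `]0%R, u[) (v `^ p)%:E)%E.
    rewrite -ge0_integralZl_EFin//.
    - by move=> v _; rewrite lee_fin powR_ge0.
    - by apply/measurable_EFinP; exact: measurable_funTS (measurable_powR _).
  have := integral_powRB_singular p1 u0; rewrite subr0.
  under eq_integral do rewrite subr0.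
  by move=> ->; rewrite -EFinM mulrAC mulrA.
have gp v : 0 < v -> g v = g v * v `^ (- p) * v `^ p.
  by move=> v0; rewrite -mulrA -powRD ?(gt_eqF v0) ?implybT// addNr powRr0 mulr1.
(* The lower coefficient is truncated at 0 because the comparison of integrals requires a
   nonnegative minorant. *)
pose k1 := Num.max 0 (c - e * (p + 1)).
(* The sign is read off at one sample point, v = u/2, where g(v) v^(-p) >= 0. *)
have k2 : 0 <= c + e * (p + 1).
  have [v0 gv0] : 0 < u / 2 /\ 0 <= g (u / 2) * (u / 2) `^ (- p).
    have hu : `]0, u[%classic (u / 2) by rewrite /= in_itv/=; lra.
    have [? ? _] := hd _ hu; split=> //.
    by rewrite mulr_ge0// powR_ge0.
  have hu : `]0, u[%classic (u / 2) by rewrite /= in_itv/=; lra.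
  have [_ _] := hd _ hu; rewrite ler_norml => /andP[]; lra.
have k10 : 0 <= k1 by rewrite le_max lexx.
have ub : (\int[mu]_(v in `]0%R, u[) (g v)%:E <=
    ((c + e * (p + 1)) / (p + 1) * u `^ (p + 1))%:E)%E.
  rewrite -Ip//; apply: ge0_le_integral_nonmeasurable => v /hd[v0 gv0 hv].
    by rewrite lee_fin.
  rewrite lee_fin gp// ler_wpM2r ?powR_ge0//.
  by move: hv; rewrite ler_norml => /andP[]; lra.
have lb : ((k1 / (p + 1) * u `^ (p + 1))%:E <= \int[mu]_(v in `]0%R, u[) (g v)%:E)%E.
  rewrite -Ip//; apply: ge0_le_integral_nonmeasurable => v /hd[v0 gv0 hv].
    by rewrite lee_fin mulr_ge0// powR_ge0.
  rewrite lee_fin gp// ler_wpM2r ?powR_ge0// ge_max mulr_ge0 ?powR_ge0//=.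
  by move: hv; rewrite ler_norml => /andP[]; lra.
have fin : (\int[mu]_(v in `]0%R, u[) (g v)%:E)%E \is a fin_num.
  rewrite ge0_fin_numE ?(le_lt_trans ub) ?ltry//.
  by apply: integral_ge0 => v /hd[_ ? _]; rewrite lee_fin.
move: lb ub; rewrite /Rintegral -(fineK fin) !lee_fin => lb ub.
have ek : e = e * (p + 1) / (p + 1) by rewrite mulfK// gt_eqF.
rewrite ler_distl {1 2}ek -!mulrBl -!mulrDl ub andbT.
apply: le_trans lb; rewrite ler_wpM2r// ler_wpM2r ?invr_ge0 ?(ltW p10)//.
by rewrite le_max lexx orbT.
Unshelve. all: by end_near. Qed.

(** * Behaviour of the kernel near 0 *)

Lemma fBm_kernelE (H t v : R) (a := H - 1 / 2) : 0 < v < t ->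
  fBm_kernel H t v = fBm_d H * (v `^ (- a) * (t `^ a * (t - v) `^ a -
    a * \int[mu]_(z in `]v, t[) (z `^ (a - 1) * (z - v) `^ a))).
Proof.
move=> /andP[v0 vt]; rewrite /fBm_kernel -/a.
have -> : 1 / 2 - H = - a by rewrite /a opprB.
have -> : H - 3 / 2 = a - 1 by rewrite /a; lra.
rewrite powRM ?invr_ge0 ?(ltW v0) ?(ltW (lt_trans v0 vt))//.
by rewrite -(powR_inv1 (ltW v0)) -powRrM mulN1r; ring.
Qed.

(** Common reduction for both regimes: p = 2a gives the exponent p + 1 = 2H, and p = -2a gives 2 -
    2H. *)
Lemma fBm_cond_cov_asymp (H t s p c : R) : -1 < p ->
  (\forall v \near 0^'+, 0 <= fBm_kernel H t v * fBm_kernel H s v) ->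
  fBm_kernel H t v * fBm_kernel H s v * v `^ (- p) @[v --> 0^'+] --> c ->
  (fun u => fBm_cond_cov H t s u) =
    (fun u => fBm_cov H t s - c / (p + 1) * u `^ (p + 1))
      +o_ (0^'+) (fun u => u `^ (p + 1)).
Proof.
move=> p1 k0 kc; apply/eqaddoP => e e0.
have h := integral0_asymp p1 k0 kc e0.
near=> u; rewrite [`|u `^ _|]ger0_norm ?powR_ge0//.
have -> : (fBm_cond_cov H t s -
    (fun u => fBm_cov H t s - c / (p + 1) * u `^ (p + 1))) u =
    - (\int[mu]_(v in `]0, u[) (fBm_kernel H t v * fBm_kernel H s v) -
       c / (p + 1) * u `^ (p + 1)).
  by rewrite /fBm_cond_cov !fctE; ring.
by rewrite normrN; near: u.
Unshelve. all: by end_near. Qed.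

Lemma fBm_kernel_factor1_cvg (a t : R) : 0 < t ->
  t `^ a * (t - v) `^ a @[v --> 0^'+] --> t `^ (2 * a).
Proof.
move=> t0; have -> : t `^ (2 * a) = t `^ a * (t - 0) `^ a.
  by rewrite subr0 -powRD ?(gt_eqF t0) ?implybT//; congr (_ `^ _); ring.
apply: cvgMl_tmp; apply: cvg_at_right_filter.
apply: (@continuous_comp R R R (fun v => t - v) (fun y => y `^ a) 0).
  by apply: continuousB; [exact: cst_continuous|exact: id].
apply: differentiable_continuous; apply/derivable1_diffP.
by apply: derivable_powR; rewrite in_itv/= subr0 t0.
Qed.

Lemma kernel_integral_cvg_gt0 (a t : R) : 0 < a < 1 / 2 -> 0 < t ->
  \int[mu]_(z in `]v, t[) (z `^ (a - 1) * (z - v) `^ a) @[v --> 0^'+] -->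
  t `^ (2 * a) / (2 * a).
Proof.
move=> a01 t0; have a20 : 0 < 2 * a by lra.
apply: (@squeeze_cvgr _ _ _ _
  (fun v => t `^ (2 * a) / (2 * a) - ((2 * a)^-1 + (1 - 2 * a)^-1) * v `^ (2 * a))
  (cst (t `^ (2 * a) / (2 * a)))).
- near=> v; apply: kernel_integral_bounds => //; apply/andP; split.
    by near: v; exact: nbhs_right_gt.
  by near: v; exact: nbhs_right_lt.
- rewrite -[X in _ --> X]subr0 -[X in _ --> _ - X](mulr0 ((2 * a)^-1 + (1 - 2 * a)^-1)).
  apply: cvgB; first exact: cvg_cst.
  by apply: cvgMl_tmp; exact: powR_cvg0.
- exact: cvg_cst.
Unshelve. all: by end_near. Qed.

(** For v > 0 the scaling identity makes the left side exactly I(t/v), and t/v -> +oo. *)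
Lemma kernel_integral_cvg_lt0 (a t : R) : -1 < a < 0 -> 0 < t ->
  v `^ (- (2 * a)) * \int[mu]_(z in `]v, t[) (z `^ (a - 1) * (z - v) `^ a)
    @[v --> 0^'+] --> \int[mu]_(w in `]1, +oo[) scaled_integrand a w.
Proof.
move=> a01 t0.
have tv : t / v @[v --> 0^'+] --> +oo.
  apply/cvgryPge => A; near=> v.
  have v0 : 0 < v by near: v; exact: nbhs_right_gt.
  have A0 : 0 < `|A| + 1 by rewrite ltr_wpDl.
  have vA : v <= t / (`|A| + 1).
    by near: v; apply: nbhs_right_le; rewrite divr_gt0.
  rewrite ler_pdivlMr//; apply: (@le_trans _ _ ((`|A| + 1) * v)).
    by rewrite ler_wpM2r ?(ltW v0)// (le_trans (ler_norm A))// lerDl.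
  by rewrite mulrC -ler_pdivlMr.
have := cvg_comp _ _ tv (scaled_integral_cvgy a01).
apply: cvg_trans; apply: near_eq_cvg; near=> v.
have v0 : 0 < v by near: v; exact: nbhs_right_gt.
by rewrite kernel_integral_scale// mulrA -powRD ?(gt_eqF v0) ?implybT// addNr powRr0 mul1r.
Unshelve. all: by end_near. Qed.

(** After multiplication by v^(-a), the term t^a (t-v)^a carries v^(-2a), which tends to 0 as a < 0;
    only the integral term survives. *)
Lemma fBm_kernel_cvg_lt_half (H t : R) (a := H - 1 / 2) : 0 < H < 1 / 2 -> 0 < t ->
  fBm_kernel H t v * v `^ (- a) @[v --> 0^'+] -->
  fBm_d H * - (a * \int[mu]_(w in `]1, +oo[) scaled_integrand a w).
Proof.
move=> H01 t0; have a01 : -1 < a < 0 by rewrite /a; lra.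
(* The limit is rewritten with the vanishing summand 0 * t^(2a), to match [k] term by term. *)
rewrite -[X in fBm_d H * X]add0r -[X in X - _](mul0r (t `^ (2 * a))).
pose k v := fBm_d H * (v `^ (- (2 * a)) * (t `^ a * (t - v) `^ a) -
  a * (v `^ (- (2 * a)) * \int[mu]_(z in `]v, t[) (z `^ (a - 1) * (z - v) `^ a))).
have kc : k v @[v --> 0^'+] --> fBm_d H * (0 * t `^ (2 * a) -
    a * \int[mu]_(w in `]1, +oo[) scaled_integrand a w).
  apply: cvgMl_tmp; apply: cvgB.
    apply: cvgM; last exact: fBm_kernel_factor1_cvg.
    by apply: powR_cvg0; lra.
  by apply: cvgMl_tmp; exact: kernel_integral_cvg_lt0.
apply: cvg_trans kc; apply: near_eq_cvg; near=> v.
have v0 : 0 < v by near: v; exact: nbhs_right_gt.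
have vt : v < t by near: v; exact: nbhs_right_lt.
rewrite fBm_kernelE ?v0// -/a /k (_ : - (2 * a) = - a + - a); last by ring.
by rewrite powRD ?(gt_eqF v0) ?implybT//; ring.
Unshelve. all: by end_near. Qed.

Lemma fBm_d_ge0 (H : R) : 0 <= fBm_d H.
Proof. exact: sqrtr_ge0. Qed.

(** For a < 0 both t^a (t-v)^a and -a J(v) are nonnegative. *)
Lemma fBm_kernel_ge0_lt_half (H t v : R) : 0 < H < 1 / 2 -> 0 < v < t ->
  0 <= fBm_kernel H t v.
Proof.
move=> H01 vt; rewrite fBm_kernelE// mulr_ge0 ?fBm_d_ge0// mulr_ge0 ?powR_ge0//.
rewrite subr_ge0 (@le_trans _ _ 0) ?mulr_ge0 ?powR_ge0// mulr_le0_ge0//; first lra.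
by apply: Rintegral_ge0 => z _; rewrite mulr_ge0// powR_ge0.
Qed.

(** For a > 0 the bracket [k] is a difference of nonnegative terms. Its limit t^(2a) - a t^(2a)/(2a)
    = t^(2a)/2 is positive, which yields the sign of the kernel near 0. *)
Lemma fBm_kernel_cvg_gt_half (H t : R) (a := H - 1 / 2) : 1 / 2 < H < 1 -> 0 < t ->
  (\forall v \near 0^'+, 0 <= fBm_kernel H t v) /\
  fBm_kernel H t v * v `^ a @[v --> 0^'+] --> fBm_d H * (t `^ (2 * a) / 2).
Proof.
move=> H01 t0; have a01 : 0 < a < 1 / 2 by rewrite /a; lra.
pose k v := t `^ a * (t - v) `^ a -
  a * \int[mu]_(z in `]v, t[) (z `^ (a - 1) * (z - v) `^ a).
have kc : k v @[v --> 0^'+] --> t `^ (2 * a) / 2.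
  rewrite (_ : _ / 2 = t `^ (2 * a) - a * (t `^ (2 * a) / (2 * a))); last first.
    by field; rewrite gt_eqF//; lra.
  apply: cvgB; first exact: fBm_kernel_factor1_cvg.
  by apply: cvgMl_tmp; exact: kernel_integral_cvg_gt0.
have kE : \forall v \near 0^'+, 0 < v /\ fBm_kernel H t v = fBm_d H * (v `^ (- a) * k v).
  near=> v.
  have v0 : 0 < v by near: v; exact: nbhs_right_gt.
  have vt : v < t by near: v; exact: nbhs_right_lt.
  by split=> //; rewrite fBm_kernelE ?v0.
split.
  have kgt0 : \forall v \near 0^'+, 0 < k v.
    by apply: (cvgr_gt _ kc); rewrite divr_gt0// powR_gt0.
  near=> v; have [v0 ->] : 0 < v /\ fBm_kernel H t v = fBm_d H * (v `^ (- a) * k v).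
    by near: v.
  rewrite mulr_ge0 ?fBm_d_ge0// mulr_ge0 ?powR_ge0// ltW//.
  by near: v.
have dkc : fBm_d H * k v @[v --> 0^'+] --> fBm_d H * (t `^ (2 * a) / 2).
  exact: cvgMl_tmp.
apply: cvg_trans dkc; apply: near_eq_cvg; near=> v.
have [v0 ->] : 0 < v /\ fBm_kernel H t v = fBm_d H * (v `^ (- a) * k v) by near: v.
by rewrite -mulrA mulrAC -powRD ?(gt_eqF v0) ?implybT// addNr powRr0 mul1r.
Unshelve. all: by end_near. Qed.
End FractionalKernel.

(** * The two regimes of H *)

Theorem proposition3p2 (R : realType) (t s : R) (hs : 0 < s) (hst : s <= t) :
  (forall H : R, 0 < H < 1 / 2 ->
     (fun u : R => fBm_cond_cov H t s u) =
       (fun u : R => fBm_cov H t s - small_H_const H * u `^ (2 * H))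
       +o_ (0^'+) (fun u : R => u `^ (2 * H)))
  /\
  (forall H : R, 1 / 2 < H < 1 ->
     (fun u : R => fBm_cond_cov H t s u) =
       (fun u : R => fBm_cov H t s - large_H_const H t s * u `^ (2 - 2 * H))
       +o_ (0^'+) (fun u : R => u `^ (2 - 2 * H))).
Proof.
have t0 : 0 < t by exact: lt_le_trans hst.
split=> H H01; pose a := H - 1 / 2.
- have kt := fBm_kernel_cvg_lt_half H01 t0.
  have ks := fBm_kernel_cvg_lt_half H01 hs.
  set I := (X in fBm_d H * - (_ * X)) in kt ks.
  have IE : \int[lebesgue_measure]_(w in `]1, +oo[)
      (w `^ (H - 3 / 2) * (w - 1) `^ (H - 1 / 2)) = I.
    rewrite (_ : H - 3 / 2 = H - 1 / 2 - 1)//; lra.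
  (* Here p = 2a, and the constant is the product of the two kernel limits divided by p + 1 = 2H. *)
  have -> : small_H_const H = (fBm_d H * - (a * I)) * (fBm_d H * - (a * I)) / (2 * a + 1).
    by rewrite /small_H_const IE /a; field; rewrite !gt_eqF//=; lra.
  have -> : 2 * H = 2 * a + 1 by rewrite /a; lra.
  apply: fBm_cond_cov_asymp; first by rewrite /a; lra.
    near=> v.
    have v0 : 0 < v by near: v; exact: nbhs_right_gt.
    have vs : v < s by near: v; exact: nbhs_right_lt.
    by rewrite mulr_ge0// fBm_kernel_ge0_lt_half// v0//= (lt_le_trans vs).
  have kts : (fBm_kernel H t v * v `^ (- a)) * (fBm_kernel H s v * v `^ (- a))
      @[v --> 0^'+] --> (fBm_d H * - (a * I)) * (fBm_d H * - (a * I)).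
    exact: cvgM.
  apply: cvg_trans kts; apply: near_eq_cvg; near=> v.
  have v0 : 0 < v by near: v; exact: nbhs_right_gt.
  rewrite mulrACA -powRD ?(gt_eqF v0) ?implybT//.
  by congr (_ * _ `^ _); ring.
- have [kt0 kt] := fBm_kernel_cvg_gt_half H01 t0.
  have [ks0 ks] := fBm_kernel_cvg_gt_half H01 hs.
  (* Here p = -2a; the two factors 1/2 and p + 1 = 2 - 2H combine into the denominator 8 - 8H. *)
  have -> : large_H_const H t s = (fBm_d H * (t `^ (2 * a) / 2)) *
      (fBm_d H * (s `^ (2 * a) / 2)) / (- (2 * a) + 1).
    rewrite /large_H_const powRM ?ltW// (_ : 2 * H - 1 = 2 * a); last by rewrite /a; lra.
    by rewrite /a; field; rewrite !gt_eqF//=; lra.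
  have -> : 2 - 2 * H = - (2 * a) + 1 by rewrite /a; lra.
  apply: fBm_cond_cov_asymp; first by rewrite /a; lra.
    by apply: filterS2 kt0 ks0 => v; exact: mulr_ge0.
  have kts : (fBm_kernel H t v * v `^ a) * (fBm_kernel H s v * v `^ a)
      @[v --> 0^'+] --> (fBm_d H * (t `^ (2 * a) / 2)) * (fBm_d H * (s `^ (2 * a) / 2)).
    exact: cvgM.
  apply: cvg_trans kts; apply: near_eq_cvg; near=> v.
  have v0 : 0 < v by near: v; exact: nbhs_right_gt.
  rewrite mulrACA -powRD ?(gt_eqF v0) ?implybT//.
  by congr (_ * _ `^ _); ring.
Unshelve. all: by end_near. Qed.
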